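(* Let $m,n \ge 2$ be integers and let $G_{m,n}$ be the $m \times n$ grid graph. Then $f(G_{m,n}) \le 2\lceil \log m \rceil + 2\lceil \log n \rceil$.
   Context: $\log$ is base 2. The $m\times n$ grid $G_{m,n}$ has vertex set $\{0,\dots,m-1\}\times\{0,\dots,n-1\}$, with $(i,j)$ adjacent to $(i',j')$ iff $|i-i'|+|j-j'|=1$. A path in a graph $G$ is a sequence of distinct vertices $v_0,\dots,v_r$ ($r\ge 0$) with consecutive vertices adjacent. A vertex-separating path system of $G$ is a collection of distinct paths in $G$ such that for every pair of distinct vertices $u,v$ some path in the collection contains exactly one of $u$ and $v$. $f(G)$ denotes the minimum size of a vertex-separating path system of $G$. *)

(* Defs.v *)
From mathcomp Require Import all_boot all_order all_algebra.
From mathcomp Require Import boolp.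

Set Implicit Arguments.
Unset Strict Implicit.
Unset Printing Implicit Defensive.

(* A finite graph is given by its adjacency relation on a finType of vertices. *)

(* Paths are vertex sequences: a path and its reversal count as distinct, which
   does not affect minimum sizes as they have the same vertices. *)
Definition is_path (T : finType) (e : rel T) (p : seq T) : bool :=
  [&& p != [::], sorted e p & uniq p].

Definition is_path_system (T : finType) (e : rel T) (P : seq (seq T)) : Prop :=
  uniq P /\ (forall p, p \in P -> is_path e p).

Definition vertex_separating (T : finType) (P : seq (seq T)) : Prop :=
  forall u v : T, u != v -> exists2 p, p \in P & (u \in p) (+) (v \in p).

Definition is_vsps (T : finType) (e : rel T) (P : seq (seq T)) : Prop :=
  is_path_system e P /\ vertex_separating P.

(* The one-vertex paths separate, so the minimum below is always attained. *)
Lemma vsps_exists (T : finType) (e : rel T) :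
  exists k, `[< exists2 P, is_vsps e P & size P = k >].
Proof.
exists #|T|; apply/asboolP; exists [seq [:: x] | x <- enum T]; last first.
  by rewrite size_map -cardE.
split; first split.
- by rewrite map_inj_uniq ?enum_uniq // => x y [].
- by move=> p /mapP[x _ ->].
move=> u v uv; exists [:: u]; first by apply: map_f; rewrite mem_enum.
by rewrite !inE eqxx eq_sym (negPf uv).
Qed.

Definition vsp_number (T : finType) (e : rel T) : nat := ex_minn (vsps_exists e).

Definition grid (m n : nat) : rel ('I_m * 'I_n) :=
  fun x y => (`|x.1 - y.1| + `|x.2 - y.2| == 1)%N.

Lemma grid_sym (m n : nat) : symmetric (@grid m n).
Proof. by move=> x y; rewrite /grid (distnC x.1) (distnC x.2). Qed.

Lemma grid_irr (m n : nat) : irreflexive (@grid m n).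
Proof. by move=> x; rewrite /grid !distnn. Qed.

(* Main.v *)
Require Import Defs.
From mathcomp Require Import all_boot all_order all_algebra.
From mathcomp Require Import boolp.
From mathcomp Require Import zify.

Set Implicit Arguments.
Unset Strict Implicit.
Unset Printing Implicit Defensive.

(** For a set S of rows there is a snake through the grid that contains the
    rows of S entirely and meets every other row only in its first or its last
    vertex.  Starting on the other side gives a second such snake, which meets
    each row outside S in its opposite end.  So a vertex lies on both snakes if
    and only if its row is in S.  Letting S run over the sets of rows with a
    given binary digit equal to 1, the resulting pairs of snakes separate any
    two vertices in different rows; the same is done for the columns. *)

Lemma vsp_number_le (T : finType) (e : rel T) (P : seq (seq T)) :
  (forall p, p \in P -> is_path e p) -> vertex_separating P ->
  vsp_number e <= size P.
Proof.
move=> pathP sepP; apply: leq_trans (size_undup P).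
rewrite /vsp_number; case: ex_minnP => k _; apply.
apply/asboolP; exists (undup P) => //; split; first split.
- exact: undup_uniq.
- by move=> p; rewrite mem_undup; apply: pathP.
- by move=> u v /sepP[p pP uv]; exists p; rewrite // mem_undup.
Qed.

Definition bit (k i : nat) : bool := odd (i %/ 2 ^ k).

(** Induction peels off the lowest digit: digit [k.+1] of [i] is digit [k] of its half. *)
Lemma bit_inj (K i j : nat) : i < 2 ^ K -> j < 2 ^ K ->
  (forall k, k < K -> bit k i = bit k j) -> i = j.
Proof.
elim: K i j => [|K IHK] i j; first by rewrite expn0 !ltnS !leqn0 => /eqP-> /eqP->.
rewrite expnS => lti ltj eqb.
have /eqP := eqb 0 isT; rewrite /bit expn0 !divn1 => /eqP eq0.
rewrite -(odd_double_half i) -(odd_double_half j) eq0; congr (_ + _.*2).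
apply: IHK; [lia | lia |] => k ltk; have := eqb k.+1 ltk.
by rewrite /bit expnS !divnMA !divn2.
Qed.

Lemma bit_neq (K i j : nat) : i < 2 ^ K -> j < 2 ^ K -> i != j ->
  exists2 k, k < K & bit k i != bit k j.
Proof.
move=> lti ltj; have [/existsP[k nek] _|] := boolP [exists k : 'I_K, bit k i != bit k j].
  by exists k.
rewrite negb_exists => /forallP eqb /eqP[]; apply: bit_inj lti ltj _ => k ltk.
by have := eqb (Ordinal ltk); rewrite negbK => /eqP.
Qed.

Definition line_adj (m : nat) : rel 'I_m := fun i j => `|i - j|%N == 1.

Lemma line_adj_sym (m : nat) : symmetric (@line_adj m).
Proof. by move=> i j; rewrite /line_adj distnC. Qed.

Lemma sorted_line_adj_enum (m : nat) : sorted (@line_adj m) (enum 'I_m).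
Proof.
have -> : @line_adj m = relpre val (fun i j : nat => `|i - j|%N == 1) by [].
rewrite -sorted_map val_enum_ord.
suff adj_iota k i : path (fun i j : nat => `|i - j|%N == 1) i (iota i.+1 k).
  by case: m => // m; apply: adj_iota.
by elim: k i => //= k IHk i; rewrite IHk andbT; lia.
Qed.

Section Snake.

Variables (m n : nat) (S : pred 'I_m).

(** Columns are indexed by ['I_n.+1] so that both ends [ord0] and [ord_max] exist. The flag [d] says
    at which end a row is entered. *)
Definition line_end (d : bool) : 'I_n.+1 := if d then ord_max else ord0.

Definition line (d : bool) : seq 'I_n.+1 :=
  if d then rev (enum 'I_n.+1) else enum 'I_n.+1.

(** Running through a full row ends on the opposite side, hence the flip of [d]; a row outside [S]
    is crossed vertically, on the current side. *)
Fixpoint snake (d : bool) (l : seq 'I_m) : seq ('I_m * 'I_n.+1) :=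
  if l is i :: l' then
    if S i then [seq (i, j) | j <- line d] ++ snake (~~ d) l'
    else (i, line_end d) :: snake d l'
  else [::].

Lemma mem_line d j : j \in line d.
Proof. by case: d; rewrite ?mem_rev mem_enum. Qed.

Lemma line_uniq d : uniq (line d).
Proof. by case: d; rewrite ?rev_uniq enum_uniq. Qed.

Lemma head_last_enum_ord :
  head ord0 (enum 'I_n.+1) = ord0 /\ last ord0 (enum 'I_n.+1) = ord_max.
Proof.
split; apply: val_inj.
  by rewrite -nth0 /= nth_enum_ord.
by rewrite -nth_last size_enum_ord /= nth_enum_ord.
Qed.

Lemma lineP d : exists t, [/\ line d = line_end d :: t,
  path (@line_adj _) (line_end d) t & last (line_end d) t = line_end (~~ d)].
Proof.
have [hd lst] := head_last_enum_ord; have := sorted_line_adj_enum n.+1.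
have sz := size_enum_ord n.+1.
case: d; rewrite /line /line_end /=.
  case/lastP: (enum _) hd lst sz => // s x; rewrite last_rcons => + xE _; rewrite {x}xE => hd.
  rewrite rev_rcons -rev_sorted rev_rcons /=.
  (* Reversing the row reverses the relation, which is harmless by symmetry. *)
  have -> : (fun i j => @line_adj n.+1 j i) = @line_adj n.+1.
    by apply/funext => i; apply/funext => j; apply: line_adj_sym.
  move=> pt; exists (rev s); split=> //; case: s hd {pt} => [|y s] /= hd; first exact: hd.
  by rewrite rev_cons last_rcons.
by case: (enum _) hd lst sz => //= x s -> lst _ ps; exists s.
Qed.

Lemma snake_rows d l i j : (i, j) \in snake d l -> i \in l.
Proof.
elim: l d => //= k l IHl d; rewrite [i \in _]inE; case: (S k).
  by rewrite mem_cat => /orP[/mapP[j' _ [-> _]]|/IHl->]; rewrite ?eqxx ?orbT.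
by rewrite inE => /orP[/eqP[-> _]|/IHl->]; rewrite ?eqxx ?orbT.
Qed.

Lemma snake_uniq d l : uniq l -> uniq (snake d l).
Proof.
elim: l d => //= k l IHl d /andP[kl ul]; case: (S k) => /=; last first.
  by rewrite IHl // andbT; apply: contra kl => /snake_rows.
rewrite cat_uniq IHl // andbT map_inj_uniq ?line_uniq => [|x y []] //=.
apply/hasPn => -[i j] /snake_rows il.
by apply: contra kl => /mapP[j' _ [<- _]].
Qed.

(** Exposing the first vertex lets the induction glue the rest of the snake to row [i]. *)
Lemma snake_path d i l : path (@line_adj m) i l ->
  exists2 s, snake d (i :: l) = (i, line_end d) :: s
           & path (@grid m n.+1) (i, line_end d) s.
Proof.
elim: l d i => [|k l IHl] d i.
  move=> _; rewrite /snake; case: (S i); last by exists [::].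
  have [t [-> pt _]] := lineP d; exists [seq (i, j) | j <- t]; rewrite ?cats0 //.
  by rewrite path_map; apply: sub_path pt => x y; rewrite /grid /= distnn.
move=> /= /andP[ik /IHl{}IHl].
(* The snake always passes to the next row within an end column. *)
have step d' : grid (i, line_end d') (k, line_end d').
  by rewrite /grid /= distnn addn0.
have [S_i|_] := boolP (S i).
  have [t [-> pt lst]] := lineP d; have [s /= -> ps] := IHl (~~ d).
  exists ([seq (i, j) | j <- t] ++ (k, line_end (~~ d)) :: s) => //.
  rewrite cat_path path_map /= last_map lst step ps !andbT.
  by apply: sub_path pt => x y; rewrite /grid /= distnn.
by have [s /= -> ps] := IHl d; exists ((k, line_end d) :: s); rewrite //= step.
Qed.

Lemma snake_is_path d : 0 < m -> is_path (@grid m n.+1) (snake d (enum 'I_m)).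
Proof.
move=> m_gt0; apply/and3P; rewrite snake_uniq ?enum_uniq //.
have := sorted_line_adj_enum m; have := size_enum_ord m.
case: (enum _) => [|i l _] /=; first by move=> m0; rewrite -m0 in m_gt0.
by case/(snake_path d) => s /= -> ps; split.
Qed.

Lemma mem_snake d l i j : i \in l -> S i -> (i, j) \in snake d l.
Proof.
elim: l d => //= k l IHl d; rewrite [i \in _]inE => /predU1P[<-|il] S_i.
  by rewrite S_i mem_cat map_f ?mem_line.
by case: (S k); rewrite ?mem_cat ?inE IHl ?orbT.
Qed.

(** Both snakes change sides at the same rows, so they stay on opposite sides throughout. Outside
    [S] each has a single vertex in the row, and these two differ because [0 < n] makes the ends
    distinct. *)
Lemma notin_snakes d l i j : 0 < n -> uniq l -> ~~ S i ->
  (i, j) \in snake d l -> (i, j) \notin snake (~~ d) l.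
Proof.
move=> n_gt0; elim: l d => //= k l IHl d /andP[kl ul] nS_i.
case: (boolP (S k)) => [S_k|_].
  have ik t : (i, j) \notin [seq (k, j) | j <- t].
    by apply: contraL S_k => /mapP[j' _ [<- _]].
  (* Both flags flip here, so the induction hypothesis is used at [~~ d]. *)
  by rewrite !mem_cat !(negPf (ik _)); apply: IHl.
rewrite !inE => /predU1P[[-> ->]|ij].
  rewrite negb_or xpair_eqE eqxx /=; apply/andP; split.
    by case: d; rewrite /line_end -val_eqE /=; lia.
  by apply: contra kl => /snake_rows.
rewrite negb_or IHl // andbT; apply: contra kl => /eqP[<- _].
exact: snake_rows ij.
Qed.

End Snake.

(** Since [m <= 2 ^ up_log 2 m], these digits suffice to tell all row indices apart. *)
Definition snakes (m n : nat) : seq (seq ('I_m * 'I_n.+1)) :=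
  [seq snake n (fun i : 'I_m => bit k i) d (enum 'I_m)
     | k <- iota 0 (up_log 2 m), d <- [:: true; false]].

Lemma size_snakes (m n : nat) : size (snakes m n) = 2 * up_log 2 m.
Proof. by rewrite size_allpairs size_iota mulnC. Qed.

Lemma snakes_is_path (m n : nat) p :
  0 < m -> p \in snakes m n -> is_path (@grid m n.+1) p.
Proof. by move=> m_gt0 /allpairsP[[k d] [_ _ ->]]; apply: snake_is_path. Qed.

Lemma snakes_separate_rows (m n : nat) (u v : 'I_m * 'I_n.+1) :
  0 < n -> u.1 != v.1 ->
  exists2 p, p \in snakes m n & (u \in p) (+) (v \in p).
Proof.
move=> n_gt0 uv; have ltm (i : 'I_m) : i < 2 ^ up_log 2 m.
  exact: leq_trans (ltn_ord i) (up_logP m _).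
have [k ltk] := bit_neq (ltm u.1) (ltm v.1) uv.
wlog [bu bv] : u v {uv} / bit k u.1 /\ ~~ bit k v.1.
  move=> sep; case bu: (bit k u.1); case bv: (bit k v.1) => // _.
    by apply: sep; rewrite ?bu ?bv.
  by have [||p pP] := sep v u; rewrite ?bu ?bv // addbC; exists p.
move=> _; pose p d := snake n (fun i : 'I_m => bit k i) d (enum 'I_m).
have pP d : p d \in snakes m n.
  by apply: allpairs_f; [rewrite mem_iota | case: d].
have up d : u \in p d by case: u bu => i j bu; rewrite mem_snake ?mem_enum.
(* The vertex [u] is on both snakes and [v] on at most one, so a snake missing [v] separates
   them. *)
have [vp|nvp] := boolP (v \in p true); last first.
  by exists (p true); rewrite ?up ?(negPf nvp).
exists (p false); rewrite ?up //=; case: v bv vp => i j bv.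
exact: (@notin_snakes m n _ true) n_gt0 (enum_uniq _) bv.
Qed.

Definition swap (A B : Type) (x : A * B) : B * A := (x.2, x.1).

Lemma swap_inj (A B : Type) : injective (@swap A B).
Proof. by move=> [a b] [a' b'] [-> ->]. Qed.

(** Transposition turns the row snakes of the [n] by [m] grid into column snakes of the [m] by [n]
    grid. *)
Lemma is_path_swap (m n : nat) (p : seq ('I_m * 'I_n)) :
  is_path (@grid m n) p -> is_path (@grid n m) (map (@swap _ _) p).
Proof.
case/and3P => p_neq0 sp up; apply/and3P; split; first by case: p p_neq0 {sp up}.
  by rewrite sorted_map; apply: sub_sorted sp => x y; rewrite /grid /= addnC.
by rewrite map_inj_uniq //; apply: swap_inj.
Qed.

Theorem theorem11 (m n : nat) (hm : 2 <= m) (hn : 2 <= n) :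
  vsp_number (@grid m n) <= 2 * up_log 2 m + 2 * up_log 2 n.
Proof.
(* Both dimensions become successors, as [snakes] requires, and [hm], [hn] then compute to [0 < m]
   and [0 < n]. *)
case: m hm => // m hm; case: n hn => // n hn.
pose P := snakes m.+1 n ++ [seq map (@swap _ _) p | p <- snakes n.+1 m].
have <- : size P = 2 * up_log 2 m.+1 + 2 * up_log 2 n.+1.
  by rewrite size_cat size_map !size_snakes.
apply: vsp_number_le => [p|u v uv].
  rewrite mem_cat => /orP[|/mapP[q qP ->]]; first exact: snakes_is_path.
  by apply: is_path_swap; apply: snakes_is_path qP.
have [eq1|ne1] := eqVneq u.1 v.1; last first.
  by have [p pP sep] := snakes_separate_rows hn ne1; exists p; rewrite // mem_cat pP.
(* Distinct vertices in the same row differ in their columns, which are the rows after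
   transposition. *)
have ne2 : (swap u).1 != (swap v).1.
  apply: contra uv => /eqP /= eq2.
  by rewrite [u]surjective_pairing eq1 eq2 -surjective_pairing.
have [p pP sep] := snakes_separate_rows hm ne2.
have mem_swap w : (w \in map (@swap _ _) p) = (swap w \in p).
  by case: w => a b; rewrite -[RHS](mem_map (@swap_inj _ _)).
exists (map (@swap _ _) p); last by rewrite !mem_swap.
by rewrite mem_cat; apply/orP; right; apply: map_f.
Qed.
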